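(* Let $\mathcal{F}$ be the class of partial orders and let $S$ be an uncountable set. Let $G$ be a generic filter for the forcing $\operatorname{Fn}(S,\mathcal{F},\omega)$. Then in the generic extension, the generic partial order $\bigcup G$, whose underlying set is $S$, is rigid, i.e. its only order-automorphism is the identity.
   Context: $\operatorname{Fn}(S,\mathcal{F},\omega)$ is the set of all partial orders whose underlying set is a finite subset of $S$, ordered by reversed inclusion: $\mathbb{A}$ is stronger than $\mathbb{B}$ iff $\mathbb{B}$ is a substructure (suborder) of $\mathbb{A}$. The generic partial order $\bigcup G$ is the union of the orders in $G$. *)

(* Defs.v *)
From mathcomp Require Import all_boot.
From mathcomp Require Import boolp classical_sets cardinality.

Set Implicit Arguments.
Unset Strict Implicit.
Unset Printing Implicit Defensive.

(* Forcing over the universe of sets.  The ground model is Aczel's type V of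
   well-founded sets.  As usual when forcing over the universe, "phi holds in
   the generic extension V[G]" means that phi, with G read as its canonical
   name, is forced by the weakest condition *)

Inductive V : Type := vset (I : Type) (f : I -> V).

(* Extensional equality: this, and not Leibniz equality, is equality of sets *)
Fixpoint Veq (x y : V) {struct x} : Prop :=
  match x, y with
  | vset T f, vset T' g =>
      (forall i, exists j, Veq (f i) (g j)) /\
      (forall j, exists i, Veq (f i) (g j))
  end.

Definition vupair (x y : V) : V := vset (fun b : bool => if b then x else y).

Definition vpair (x y : V) : V := vupair (vupair x x) (vupair x y).

Record forcing := Forcing {
  condition :> Type;
  stronger : condition -> condition -> Prop;
  stronger_refl : forall p, stronger p p;
  stronger_trans : forall p q r,
    stronger p q -> stronger q r -> stronger p r;
  weakest : condition;
  stronger_weakest : forall p, stronger p weakest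
}.

Declare Scope forcing_scope.
Delimit Scope forcing_scope with forcing.
Notation "p <<= q" := (stronger p q) (at level 70) : forcing_scope.
Local Open Scope forcing_scope.

(* A name is a set of pairs (name, condition) *)
Inductive name (P : Type) : Type :=
  nset (I : Type) (x : I -> name P) (p : I -> P).

Fixpoint check (P : forcing) (x : V) : name P :=
  match x with vset T f => nset (fun i => check P (f i)) (fun _ => weakest P) end.

(* The canonical name {(p^, p) : p in P} of the generic filter; [code] says
   which set of the ground model each condition is *)
Definition generic_filter (P : forcing) (code : P -> V) : name P :=
  nset (fun p : P => check P (code p)) (fun p => p).

(* Formulas of set theory, with parameters and quantifiers ranging over X.
   All the formulas below are parametric in X, hence are first-order formulas
   in the language of membership and equality with the displayed parameters *)
Inductive formula (X : Type) : Type :=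
  | fBot
  | fMem of X & X
  | fEq of X & X
  | fAnd of formula X & formula X
  | fOr of formula X & formula X
  | fImp of formula X & formula X
  | fAll of (X -> formula X)
  | fEx of (X -> formula X).

Definition fIff (X : Type) (a b : formula X) := fAnd (fImp a b) (fImp b a).

Declare Scope formula_scope.
Delimit Scope formula_scope with fm.
Bind Scope formula_scope with formula.
Notation "x ∈ y" := (fMem x y) (at level 70) : formula_scope.
Notation "x ≐ y" := (fEq x y) (at level 70) : formula_scope.
Notation "a ∧ b" := (fAnd a b) (at level 80, right associativity) : formula_scope.
Notation "a ∨ b" := (fOr a b) (at level 85, right associativity) : formula_scope.
Notation "a ⇒ b" := (fImp a b) (at level 90, right associativity) : formula_scope.
Notation "a ⇔ b" := (fIff a b) (at level 95, no associativity) : formula_scope.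
Notation "∀ x .. y , a" := (fAll (fun x => .. (fAll (fun y => a)) ..))
  (at level 200, x binder, y binder, right associativity) : formula_scope.
Notation "∃ x .. y , a" := (fEx (fun x => .. (fEx (fun y => a)) ..))
  (at level 200, x binder, y binder, right associativity) : formula_scope.

Section Forces.
Variable P : forcing.

Definition dense_below (p : P) (D : P -> Prop) : Prop :=
  forall q, q <<= p -> exists r, r <<= q /\ D r.

(* p ||- x = y, with the clauses of p ||- z \in y and p ||- z \in x
   (see [forces_mem]) inlined so that the recursion is structural *)
Fixpoint forces_eq (x y : name P) (p : P) {struct x} : Prop :=
  match x, y with
  | nset T f s, nset T' g t =>
      (forall i q, q <<= p -> q <<= s i ->
         dense_below q (fun r => exists j, r <<= t j /\ forces_eq (f i) (g j) r))
   /\ (forall j q, q <<= p -> q <<= t j ->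
         dense_below q (fun r => exists i, r <<= s i /\ forces_eq (f i) (g j) r))
  end.

Definition forces_mem (x y : name P) (p : P) : Prop :=
  match y with
  | nset T' g t =>
      dense_below p (fun r => exists j, r <<= t j /\ forces_eq x (g j) r)
  end.

Fixpoint forces (p : P) (a : formula (name P)) {struct a} : Prop :=
  match a with
  | fBot => False
  | fMem x y => forces_mem x y p
  | fEq x y => forces_eq x y p
  | fAnd a b => forces p a /\ forces p b
  | fOr a b => dense_below p (fun q => forces q a \/ forces q b)
  | fImp a b => forall q, q <<= p -> forces q a -> forces q b
  | fAll a => forall x, forces p (a x)
  | fEx a => dense_below p (fun q => exists x, forces q (a x))
  end.

End Forces.

Definition generic_extension_satisfies (P : forcing) (a : formula (name P)) :=
  forces (weakest P) a.

Section Formulas.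
Variable X : Type.
Implicit Types x y z f p G S A U r R : X.
Local Open Scope formula_scope.

Definition is_upair z x y : formula X := ∀ w, w ∈ z ⇔ w ≐ x ∨ w ≐ y.

Definition is_pair z x y : formula X :=
  ∃ u v, is_upair u x x ∧ is_upair v x y ∧ is_upair z u v.

(* (x, y) \in f *)
Definition related f x y : formula X := ∃ z, is_pair z x y ∧ z ∈ f.

Definition is_relation_on U R : formula X :=
  ∀ z, z ∈ R ⇒ ∃ x y, x ∈ U ∧ y ∈ U ∧ is_pair z x y.

Definition is_partial_order U R : formula X :=
    is_relation_on U R
  ∧ (∀ x, x ∈ U ⇒ related R x x)
  ∧ (∀ x y, related R x y ⇒ related R y x ⇒ x ≐ y)
  ∧ (∀ x y z, related R x y ⇒ related R y z ⇒ related R x z).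

Definition is_bijection_on U f : formula X :=
    is_relation_on U f
  ∧ (∀ x, x ∈ U ⇒ ∃ y, related f x y)
  ∧ (∀ x y y', related f x y ⇒ related f x y' ⇒ y ≐ y')
  ∧ (∀ x x' y, related f x y ⇒ related f x' y ⇒ x ≐ x')
  ∧ (∀ y, y ∈ U ⇒ ∃ x, related f x y).

Definition is_automorphism U R f : formula X :=
    is_bijection_on U f
  ∧ (∀ x x' y y', related f x y ⇒ related f x' y' ⇒
       (related R x x' ⇔ related R y y')).

Definition is_identity_on U f : formula X :=
  ∀ z, z ∈ f ⇔ (∃ x, x ∈ U ∧ is_pair z x x).

Definition is_rigid U R : formula X :=
  ∀ f, is_automorphism U R f ⇒ is_identity_on U f.

(* (U, R) is the union of the structures (A, r) \in G *)
Definition is_union_of_structures G U R : formula X :=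
    (∀ x, x ∈ U ⇔ (∃ p A r, p ∈ G ∧ is_pair p A r ∧ x ∈ A))
  ∧ (∀ x, x ∈ R ⇔ (∃ p A r, p ∈ G ∧ is_pair p A r ∧ x ∈ r)).

Definition union_is_rigid_order_on G S : formula X :=
  ∃ U R, is_union_of_structures G U R ∧ U ≐ S
       ∧ is_partial_order U R ∧ is_rigid U R.

End Formulas.

Local Open Scope classical_set_scope.

Record finite_order (S : Type) := FiniteOrder {
  carrier : set S;
  order_rel : S -> S -> Prop;
  carrier_finite : finite_set carrier;
  order_rel_carrier : forall x y, order_rel x y -> carrier x /\ carrier y;
  order_rel_refl : forall x, carrier x -> order_rel x x;
  order_rel_anti : forall x y, order_rel x y -> order_rel y x -> x = y;
  order_rel_trans : forall x y z,
    order_rel x y -> order_rel y z -> order_rel x z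
}.

Definition suborder (S : Type) (B A : finite_order S) : Prop :=
  carrier B `<=` carrier A /\
  (forall x y, carrier B x -> carrier B y ->
     (order_rel B x y <-> order_rel A x y)).

Section Fn.
Variable S : Type.

Definition extends (A B : finite_order S) : Prop := suborder B A.

Lemma extends_refl A : extends A A.
Proof. by split. Qed.

Lemma extends_trans A B C : extends A B -> extends B C -> extends A C.
Proof.
move=> [BA AB] [CB BC]; split=> [x Cx|x y Cx Cy]; first exact/BA/CB.
by rewrite BC // AB //; exact: CB.
Qed.

Definition empty_order : finite_order S :=
  @FiniteOrder S set0 (fun _ _ => False) (@finite_set0 S)
    (fun _ _ H => False_ind _ H) (fun _ H => H)
    (fun _ _ H => False_ind _ H) (fun _ _ _ H => False_ind _ H).

Lemma extends_empty A : extends A empty_order.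
Proof. by split=> [x []|x y []]. Qed.

Definition Fn : forcing :=
  @Forcing (finite_order S) extends extends_refl extends_trans
    empty_order extends_empty.

(* When S is presented as the set {elt s | s : S}, the order A is the ordered
   pair (carrier, set of ordered pairs) *)
Definition Fn_code (elt : S -> V) (A : Fn) : V :=
  vpair (vset (fun s : {s | carrier A s} => elt (sval s)))
        (vset (fun st : {st : S * S | order_rel A st.1 st.2} =>
                 vpair (elt (sval st).1) (elt (sval st).2))).

End Fn.

(* Main.v *)
(* If a condition q0 forces that f is an automorphism with f(a) = b <> a, then
   below q0 every point s outside q0 can be made not fixed by f: extend q0 so
   that s lies above exactly one of a and b.  So uncountably many s have a
   condition q_s forcing f(s) = t_s <> s.  Two of these conditions, q_x and q_y,
   are isomorphic over their intersection, with x sent to y and t_x to t_y, and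
   they have a common extension in which x < y but t_x is not below t_y unless
   t_x = t_y; this contradicts that f is an injective order embedding. *)

Require Import Defs.
From mathcomp Require Import all_boot.
From mathcomp Require Import boolp classical_sets cardinality.

Set Implicit Arguments.
Unset Strict Implicit.
Unset Printing Implicit Defensive.

Local Open Scope classical_set_scope.

(** * Amalgamation of finite orders *)

(** Countable pigeonhole: if every fibre were finite, [X] would lie in a countable union of finite
    sets. *)
Lemma infinite_fibre (S : Type) (K : countType) (X : set S)
    (rel : K -> S -> Prop) :
  ~ countable X -> (forall s, X s -> exists k, rel k s) ->
  exists k, infinite_set [set s | X s /\ rel k s].
Proof.
move=> Xunc Xrel; apply: contrapT => noinf; apply: Xunc.
apply: (@sub_countable _ _ _ (\bigcup_(k in setT) [set s | X s /\ rel k s])).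
  by apply: subset_card_le => s Xs; have [k ks] := Xrel s Xs; exists k.
apply: bigcup_countable => // k _; apply: finite_set_countable.
by apply: contrapT => inf; apply: noinf; exists k.
Qed.

(* Replaces the Delta-system lemma: if c x y records the coincidences between
   enumerations e_x and e_y of two finite sets, then along such a triangle
   e_x i = e_y j implies i = j. *)
Lemma monochromatic_triangle (S : Type) (C : finType) (c : S -> S -> C)
    (X : set S) :
  infinite_set X ->
  exists x y z, [/\ X x, X y & x <> y] /\ (c x y = c x z /\ c y z = c x y).
Proof.
(* Ramsey's theorem for triangles, by induction on the size of a set [L] containing all colours of
   distinct points of [Y]. When [L] is empty, two distinct points of the infinite [Y] already give a
   contradiction. *)
suff Ramsey (n : nat) (L : {set C}) (Y : set S) : #|L| <= n -> infinite_set Y ->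
    (forall x y, Y x -> Y y -> x <> y -> c x y \in L) ->
    exists x y z, [/\ Y x, Y y & x <> y] /\ (c x y = c x z /\ c y z = c x y).
  by move=> Xinf; apply: (@Ramsey #|[set: C]%SET| [set: C]%SET) => // *; rewrite inE.
elim: n L Y => [|n IHn] L Y.
  rewrite leqn0 cards_eq0 => /eqP-> Yinf YL.
  have [x Yx] := infinite_setN0 Yinf.
  have [y [Yy /= nyx]] := infinite_setN0 (infinite_setD Yinf (finite_set1 x)).
  by have := YL x y Yx Yy (fun e => nyx (esym e)); rewrite inE.
move=> leL Yinf YL; have [x Yx] := infinite_setN0 Yinf.
have [k kinf] : exists k, infinite_set [set y | (Y `\ x) y /\ c x y = k].
  apply: contrapT => noinf; apply: (infinite_setD Yinf (finite_set1 x)).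
  apply: (@sub_finite_set _ _
    (\bigcup_(k in setT) [set y | (Y `\ x) y /\ c x y = k])).
    by move=> y Yy; exists (c x y).
  apply: bigcup_finite => // k _.
  by apply: contrapT => inf; apply: noinf; exists k.
(* Either two distinct points of the infinite fibre also have colour [k], which closes a triangle
   with [x], or [k] never occurs between distinct points of the fibre and the induction hypothesis
   applies to the fibre with [k] removed from [L]. *)
have [[y [z [[[Yy nyx] cxy] [[Yz nzx] cxz] nyz cyz]]]|noyz] := pselect
    (exists y z, [/\ (Y `\ x) y /\ c x y = k, (Y `\ x) z /\ c x z = k,
       y <> z & c y z = k]).
  exists x, y, z; split; first by split=> // exy; apply: nyx.
  by rewrite cxy cxz cyz.
have [y0 [[Yy0 ny0x] cxy0]] := infinite_setN0 kinf.
have kL : k \in L by rewrite -cxy0; apply: YL => // e; apply: ny0x.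
have [||y [z [w [[[[Yy _] _] [[Yz _] _] nyz] cc]]]] := IHn (L :\ k)%SET _ _ kinf.
- by move: leL; rewrite (cardsD1 k) kL.
- move=> y z Yy Yz nyz; rewrite !inE; apply/andP; split.
    by apply/eqP => cyz; apply: noyz; exists y, z.
  by apply: YL => //; [case: Yy => -[]|case: Yz => -[]].
by exists y, z, w.
Qed.

Lemma finite_order_enum (S : Type) (A : finite_order S) :
  exists n (e : 'I_n -> S),
    injective e /\ (forall x, carrier A x <-> exists i, e i = x).
Proof.
have /finite_seqP[s As] := @carrier_finite {classic S} A.
exists (size (undup s)), (tnth (in_tuple (undup s))); split=> [|x].
  by exact/(@tuple_uniqP _ {classic S} (in_tuple (undup s)))/undup_uniq.
rewrite As /= -(@mem_undup {classic S}); split=> [xs|[i <-]]; last exact: mem_tnth.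
by have /tnthP[i ->] : (x : {classic S}) \in in_tuple (undup s) := xs; exists i.
Qed.

(** * Adding one point to a finite order *)

Section OnePointExtension.
Variables (S : Type) (A : finite_order S) (D : set S) (s : S).
Hypothesis sNA : ~ carrier A s.
Hypothesis DA : D `<=` carrier A.
Hypothesis D_down : forall x y, order_rel A x y -> D y -> D x.

(** The new point [s] sits on top of the down-set [D] and below no point of [A], so the order on [A]
    is untouched. *)
Definition one_point_rel (x y : S) : Prop :=
  order_rel A x y \/ (y = s /\ (x = s \/ D x)).

Lemma one_point_extension :
  exists C, [/\ extends C A, carrier C s &
    forall x y, order_rel C x y <-> one_point_rel x y].
Proof.
have sL x : ~ order_rel A s x by move=> xy; have [] := order_rel_carrier xy.
have sR x : ~ order_rel A x s by move=> xy; have [] := order_rel_carrier xy.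
have sD : ~ D s by move=> /DA.
unshelve eexists (@FiniteOrder S (s |` carrier A) one_point_rel _ _ _ _ _).
- by rewrite finite_setU; split=> //; exact: carrier_finite.
- move=> x y [xy|[-> [->|/DA Ax]]].
  + by have [] := order_rel_carrier xy; split; right.
  + by split; left.
  + by split; [right|left].
- by move=> x [->|Ax]; [right; split=> //; left|left; exact: order_rel_refl].
- move=> x y [xy|[-> xs]] [yx|[e yD]].
  + exact: order_rel_anti xy yx.
  + by rewrite e in xy; case: (sL y).
  + by case: (sL x).
  + by rewrite e.
- move=> x y z [xy|[-> xD]] [yz|[-> yD]].
  + by left; apply: order_rel_trans xy yz.
  + case: yD xy => [->|Dy] xy; first by case: (sR x).
    by right; split=> //; right; apply: D_down xy Dy.
  + by case: (sL z).
  + by right.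
split=> //; last by left.
split=> [x Ax|x y Ax Ay]; first by right.
by split=> [|[//|[e _]]]; [left|move: Ay; rewrite e].
Qed.

End OnePointExtension.

Lemma extends_with_point (S : Type) (A : finite_order S) (s : S) :
  exists C, extends C A /\ carrier C s.
Proof.
have [As|nAs] := pselect (carrier A s).
  by exists A; split=> //; exact: extends_refl.
have [||C [CA Cs _]] := @one_point_extension _ A set0 s nAs.
- by move=> x [].
- by [].
by exists C.
Qed.

(** By antisymmetry one of [a], [b] does not have the other below it; [s] is put on top of the
    principal down-set of that one. *)
Lemma extends_separating (S : Type) (A : finite_order S) (a b s : S) :
  carrier A a -> carrier A b -> a <> b -> ~ carrier A s ->
  exists C, [/\ extends C A, carrier C s &
    ~ (order_rel C a s <-> order_rel C b s)].
Proof.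
move=> Aa Ab nab nAs.
have sep c d : carrier A c -> ~ order_rel A d c -> carrier A d ->
    exists C, [/\ extends C A, carrier C s, order_rel C c s & ~ order_rel C d s].
  move=> Ac ndc Ad.
  have [||C [CA Cs Crel]] := @one_point_extension _ A [set x | order_rel A x c] s nAs.
  - by move=> x xc; have [] := order_rel_carrier xc.
  - by move=> x y /= xy; exact: order_rel_trans.
  exists C; split=> //; rewrite Crel; first by right; split=> //; right; exact: order_rel_refl.
  case=> [ds|[_ [ds|//]]]; first by have [] := order_rel_carrier ds.
  by apply: nAs; rewrite -ds.
have [ba|nba] := pselect (order_rel A b a); last first.
  by have [C [CA Cs Ca Cb]] := sep a b Aa nba Ab; exists C; split=> // -[] /(_ Ca).
have nab' : ~ order_rel A a b by move=> ab; apply: nab; exact: order_rel_anti ab ba.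
by have [C [CA Cs Cb Ca]] := sep b a Ab nab' Aa; exists C; split=> // -[] _ /(_ Cb).
Qed.

(** * Amalgamating two isomorphic orders over their common root *)

Section Amalgam.
Variables (S : Type) (A B : finite_order S) (n : nat) (eA eB : 'I_n -> S).
Variable i0 : 'I_n.
Hypothesis eA_inj : injective eA.
Hypothesis eB_inj : injective eB.
Hypothesis eA_carrier : forall x, carrier A x <-> exists i, eA i = x.
Hypothesis eB_carrier : forall x, carrier B x <-> exists i, eB i = x.
Hypothesis AB_iso : forall i j,
  order_rel A (eA i) (eA j) <-> order_rel B (eB i) (eB j).
Hypothesis root : forall i j, eA i = eB j -> i = j.

Let e (b : bool) := if b then eB else eA.
Let le i j := order_rel A (eA i) (eA j).

(* Passing from A to B goes through the root or through the new relation
   eA i0 <= eB i0; passing from B to A goes through the root. *)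
Let pre (b : bool) i (b' : bool) j : Prop :=
  if b == b' then le i j
  else exists c, [/\ le i c, le c j & eA c = eB c \/ (~~ b /\ c = i0)].

Definition amalgam_rel (x y : S) : Prop :=
  exists b i b' j, [/\ e b i = x, e b' j = y & pre b i b' j].

Let le_refl i : le i i.
Proof. by apply: order_rel_refl; apply/eA_carrier; exists i. Qed.

Let le_trans j i k : le i j -> le j k -> le i k.
Proof. exact: order_rel_trans. Qed.

Let le_anti i j : le i j -> le j i -> i = j.
Proof. by move=> ij ji; apply: eA_inj; exact: order_rel_anti ij ji. Qed.

Let pre_le b i b' j : pre b i b' j -> le i j.
Proof. by rewrite /pre; case: eqP => // _ [c [ic cj _]]; exact: le_trans ic cj. Qed.

(** If the outer sides agree, transitivity of [le] suffices. Otherwise exactly one of the two steps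
    changes sides, and its crossing point [c] serves for the composite. *)
Let pre_trans b1 i1 b2 i2 b3 i3 :
  pre b1 i1 b2 i2 -> pre b2 i2 b3 i3 -> pre b1 i1 b3 i3.
Proof.
move=> p12 p23; have [l12 l23] := (pre_le p12, pre_le p23); move: p12 p23.
rewrite /pre; case: b1; case: b2; case: b3 => //=;
  try by move=> *; exact: le_trans l12 l23.
- by move=> _ [c [ic cj H]]; exists c; split=> //; exact: le_trans l12 ic.
- by move=> [c [ic cj H]] _; exists c; split=> //; exact: le_trans cj l23.
- by move=> [c [ic cj H]] _; exists c; split=> //; exact: le_trans cj l23.
- by move=> _ [c [ic cj H]]; exists c; split=> //; exact: le_trans l12 ic.
Qed.

Let eq_pre b i b' j : e b i = e b' j -> i = j /\ pre b i b' j.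
Proof.
rewrite /pre; case: b; case: b' => /= eij.
- by rewrite (eB_inj eij).
- have eji := root (esym eij); rewrite eji in eij *; split=> //.
  by exists i; split=> //; left.
- have eji := root eij; rewrite -eji in eij *; split=> //.
  by exists i; split=> //; left.
- by rewrite (eA_inj eij).
Qed.

(** A root point carries two labels, one for each side. Coinciding labels are [pre]-related, so by
    transitivity [pre] does not depend on the label chosen. *)
Let amalgam_relE b i b' j : amalgam_rel (e b i) (e b' j) <-> pre b i b' j.
Proof.
split=> [[c [k [c' [l [/esym/eq_pre[_ ik] /eq_pre[_ lj] kl]]]]]|]; last by exists b, i, b', j.
exact: pre_trans (pre_trans ik kl) lj.
Qed.

(** A crossing point between [eA i] and [eB i] lies both above and below [i] in [le], hence is [i]
    itself. This is allowed only at a root point or at [i0], so the relation forced at [i0] creates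
    no other comparison of this kind. *)
Lemma amalgam : exists C, [/\ extends C A, extends C B,
  order_rel C (eA i0) (eB i0) &
  forall i, i <> i0 -> eA i <> eB i -> ~ order_rel C (eA i) (eB i)].
Proof.
have amC x y : amalgam_rel x y -> exists b i b' j, [/\ x = e b i, y = e b' j & pre b i b' j].
  by move=> [b [i [b' [j [<- <- H]]]]]; exists b, i, b', j.
have carE x : (carrier A `|` carrier B) x <-> exists b i, e b i = x.
  split=> [[/eA_carrier[i <-]|/eB_carrier[i <-]]|[[] [i <-]]].
  - by exists false, i.
  - by exists true, i.
  - by right; apply/eB_carrier; exists i.
  - by left; apply/eA_carrier; exists i.
unshelve eexists (@FiniteOrder S (carrier A `|` carrier B) amalgam_rel _ _ _ _ _).
- by rewrite finite_setU; split; exact: carrier_finite.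
- move=> x y [b [i [b' [j [xi yj _]]]]].
  by split; apply/carE; [exists b, i|exists b', j].
- by move=> x /carE[b [i <-]]; apply/amalgam_relE; rewrite /pre eqxx.
- move=> x y xy yx; case: (amC _ _ xy) => b [i [b' [j [xi yj _]]]].
  move: xy yx; rewrite {}xi {}yj => /amalgam_relE ij /amalgam_relE ji.
  (* The indices agree. If the sides differ, one of the two comparisons runs from [B] to [A]; its
     crossing point has this same index and must be a root point, so both labels name one point. *)
  have eij := le_anti (pre_le ij) (pre_le ji); subst j.
  move: ij ji; rewrite /pre; case: b; case: b' => //=.
  + move=> [c [ic ci H]] _; have eic := le_anti ic ci; subst c.
    by case: H => [->|[]].
  + move=> _ [c [ic ci H]]; have eic := le_anti ic ci; subst c.
    by case: H => [->|[]].
- move=> x y z xy yz; case: (amC _ _ xy) => b [i [b' [j [xi yj _]]]].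
  case: (amC _ _ yz) => _ [_ [c [k [_ zk _]]]].
  move: xy yz; rewrite {}xi {}yj {}zk => /amalgam_relE ij /amalgam_relE jk.
  by apply/amalgam_relE; exact: pre_trans ij jk.
split=> /=.
- split=> [x Ax|x y /eA_carrier[i <-] /eA_carrier[j <-] /=]; first by left.
  by rewrite (amalgam_relE false i false j).
- split=> [x Ax|x y /eB_carrier[i <-] /eB_carrier[j <-] /=]; first by right.
  by rewrite (amalgam_relE true i true j) -AB_iso.
- by apply/(amalgam_relE false i0 true i0); exists i0; split=> //; right.
- move=> i nii0 nAB /(amalgam_relE false i true i)[c [ic ci H]].
  by have eic := le_anti ic ci; subst c; case: H => [|[_]].
Qed.

End Amalgam.

(** [F s t q] abstracts the statement that [q] forces an automorphism to send [s] to [t]. The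
    hypotheses are what [p] forces about it, so the combinatorics runs without names. *)
Lemma invariant_assignment_trivial (S : Type) (p : finite_order S)
    (F : S -> S -> finite_order S -> Prop) :
  ~ countable [set: S] ->
  (forall s t q r, F s t q -> extends r q -> F s t r) ->
  (forall s q, extends q p -> exists r t, extends r q /\ F s t r) ->
  (forall s s' t q, extends q p -> F s t q -> F s' t q -> s = s') ->
  (forall s s' t t' q, extends q p -> F s t q -> F s' t' q ->
     carrier q s -> carrier q s' -> carrier q t -> carrier q t' ->
     (order_rel q s s' <-> order_rel q t t')) ->
  forall s t q, extends q p -> F s t q -> s = t.
Proof.
move=> S_unc F_mono F_total F_inj F_order a b q qp Fab; apply: contrapT => nab.
have [qa [qaq qaa]] := extends_with_point q a.
have [q0 [q0qa q0b]] := extends_with_point qa b.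
have q0q := extends_trans q0qa qaq; have q0p := extends_trans q0q qp.
have q0a : carrier q0 a by exact: q0qa.1.
have {q qaq q0q qa qaa q0qa qp} Fab : F a b q0 by exact: F_mono Fab q0q.
have moved s : ~ carrier q0 s -> exists r t, [/\ extends r q0, F s t r, s <> t,
    carrier r s & carrier r t].
  move=> nq0s; have [r0 [r0q0 r0s sep]] := extends_separating q0a q0b nab nq0s.
  have [r1 [t [r1r0 Fst]]] := F_total s r0 (extends_trans r0q0 q0p).
  have [r [rr1 rt]] := extends_with_point r1 t.
  have rr0 := extends_trans rr1 r1r0; have rq0 := extends_trans rr0 r0q0.
  have rs := rr0.1 _ r0s; have Frst := F_mono _ _ _ _ Fst rr1.
  (* If [s] were its own image, order preservation applied to [a], [s] and their images [b], [s]
     would make a ≤ s equivalent to b ≤ s. *)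
  exists r, t; split=> // est; subst t; apply: sep.
  have [r0a r0b] := (r0q0.1 _ q0a, r0q0.1 _ q0b).
  rewrite (rr0.2 _ _ r0a r0s) (rr0.2 _ _ r0b r0s).
  have Frab := F_mono _ _ _ _ Fab rq0.
  by apply: (F_order _ _ _ _ r) => //; [exact: extends_trans q0p|exact: rr0.1..].
have X_unc : ~ countable (~` carrier q0).
  apply: contra_not S_unc => Xc; rewrite -(setUv (carrier q0)).
  rewrite -bigcup2E; apply: bigcup_countable => // -[|[|i]] _ //=.
  exact/finite_set_countable/carrier_finite.
(* The isomorphism type of a moved point: the size of its condition, the indices of the point and of
   its image, and the order read on indices. There are countably many types, so infinitely many
   points share one. *)
pose K : countType := {n : nat & 'I_n * 'I_n * {ffun 'I_n * 'I_n -> bool}}%type.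
pose realizes n (i0 i1 : 'I_n) (tau : {ffun 'I_n * 'I_n -> bool}) s r (e : 'I_n -> S) :=
  [/\ extends r q0, F s (e i1) r, e i0 = s, s <> e i1 &
    [/\ injective e, forall x, carrier r x <-> exists i, e i = x &
      forall i j, order_rel r (e i) (e j) <-> tau (i, j)]].
pose typ (k : K) s := let: existT n (i0, i1, tau) := k in
  exists r e, @realizes n i0 i1 tau s r e.
have [|[n [[i0 i1] tau]] /= Yinf] := @infinite_fibre _ K _ typ X_unc.
  move=> s /moved[r [t [rq0 Fst nst rs rt]]].
  have [n [e [e_inj er]]] := finite_order_enum r.
  have [/er[i0 ei0] /er[i1 ei1]] := (rs, rt); subst t.
  exists (existT _ n (i0, i1, [ffun ij => `[< order_rel r (e ij.1) (e ij.2) >]])).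
  exists r, e; split=> //; split=> // i j; rewrite ffunE /=.
  by split=> [H|/asboolP//]; apply/asboolP.
set Y := (X in infinite_set X) in Yinf.
(* One enumeration is fixed for each point of [Y]; the constant one outside [Y] is a dummy value,
   needed because the colouring is defined on all of [S]. *)
have /choice[e eY] : forall s, exists e : 'I_n -> S, Y s ->
    exists r, realizes n i0 i1 tau s r e.
  move=> s; have [[_ [r [e res]]]|nYs] := pselect (Y s); last by exists (fun=> s).
  by exists e => _; exists r.
have [x [y [z [[Yx Yy nxy] [cxy cyz]]]]] := @monochromatic_triangle S {set 'I_n * 'I_n}
  (fun x y => [set ij | `[< e x ij.1 = e y ij.2 >]]%SET) Y Yinf.
have [A [Aq0 FA ex0 nx1 [ex_inj exA Atau]]] := eY x Yx.
have [B [Bq0 FB ey0 ny1 [ey_inj eyB Btau]]] := eY y Yy.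
(* Equal colours turn [e x i = e y j] into [e x i = e z j] and [e y i = e z j]. Hence
   [e y i = e y j], and injectivity applies. *)
have root i j : e x i = e y j -> i = j.
  move=> exy; have ij : (i, j) \in [set ij | `[< e x ij.1 = e y ij.2 >]]%SET.
    by rewrite inE; apply/asboolP.
  have := ij; rewrite cxy inE => /asboolP /= exz.
  by move: ij; rewrite -cyz inE => /asboolP /= eyz; apply: ey_inj; rewrite -exy exz -eyz.
have [i j|C [CA CB Cxy Cn]] := @amalgam _ A B n _ _ i0 ex_inj ey_inj exA eyB _ root.
  by rewrite Atau Btau.
have Cp : extends C p by exact: extends_trans CA (extends_trans Aq0 q0p).
have [FCx FCy] := (F_mono _ _ _ _ FA CA, F_mono _ _ _ _ FB CB).
(* A common image contradicts injectivity. Otherwise [i1] differs from [i0] because [x] is moved, so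
   [C] has [x] below [y] without the image of [x] below that of [y]. *)
have [e1|ne1] := pselect (e x i1 = e y i1).
  by apply: nxy; apply: F_inj Cp FCx _; rewrite e1.
apply: (Cn i1 _ ne1) => [e10|]; first by apply: nx1; rewrite e10 ex0.
have Ce i : carrier C (e x i).
  by apply: (CA.1); apply/exA; exists i.
have Ce' i : carrier C (e y i).
  by apply: (CB.1); apply/eyB; exists i.
have [Cx Cy] := (Ce i0, Ce' i0); rewrite ex0 in Cx; rewrite ey0 in Cy.
rewrite ex0 ey0 in Cxy.
exact: (F_order _ _ _ _ _ Cp FCx FCy Cx Cy (Ce _) (Ce' _)).1.
Qed.

Local Open Scope forcing_scope.

(** * The forcing relation *)

Section ForcingRelation.
Variable P : forcing.
Implicit Types (p q r : P) (x y z w : name P) (a b : formula (name P)).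
Implicit Types Q D : P -> Prop.

(** These are the regular open sets of conditions. A goal of this form may be proved on a dense set
    below [p], which is how forced existentials and disjunctions yield witnesses. *)
Definition regular Q : Prop :=
  (forall p q, q <<= p -> Q p -> Q q) /\ (forall p, dense_below p Q -> Q p).

Lemma dense_below_mono p q D : q <<= p -> dense_below p D -> dense_below q D.
Proof. by move=> qp pD r rq; apply: pD; exact: stronger_trans qp. Qed.

Lemma dense_below_sub p D Q : (forall q, q <<= p -> D q -> Q q) ->
  dense_below p D -> dense_below p Q.
Proof.
move=> DQ pD q qp; have [r [rq Dr]] := pD q qp; exists r; split=> //.
by apply: DQ => //; exact: stronger_trans qp.
Qed.

Lemma dense_below_of p D : (forall q, q <<= p -> D q) -> dense_below p D.
Proof. by move=> pD q qp; exists q; split; [exact: stronger_refl|exact: pD]. Qed.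

Lemma dense_below_regular D : regular (fun p => dense_below p D).
Proof.
split=> [p q|p pD q qp]; first exact: dense_below_mono.
have [r [rq rD]] := pD q qp.
have [t [tr Dt]] := rD r (stronger_refl r).
by exists t; split=> //; exact: stronger_trans rq.
Qed.

Lemma dense_below_elim D Q p : dense_below p D -> regular Q ->
  (forall q, q <<= p -> D q -> Q q) -> Q p.
Proof. by move=> pD [_ Qreg] DQ; apply: Qreg; exact: dense_below_sub pD. Qed.

(** No induction on names is needed: both clauses of forced equality end in [dense_below], which is
    itself regular. *)
Lemma forces_eq_regular x y : regular (forces_eq x y).
Proof.
have mono p q : q <<= p -> forces_eq x y p -> forces_eq x y q.
  case: x y => [I f s] [J g t] qp /= [xy yx].
  by split=> [i r rq|j r rq]; [apply: xy|apply: yx]; exact: stronger_trans qp.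
split=> // p; case: x y mono => [I f s] [J g t] mono H.
split=> [i q qp qs|j q qp qt]; apply: (dense_below_regular _).2 => r rq;
  have [r' [r'r H']] := H r (stronger_trans rq qp); exists r'; split=> //.
- by apply: H'.1; [exact: stronger_refl|exact: stronger_trans (stronger_trans r'r rq) qs].
- by apply: H'.2; [exact: stronger_refl|exact: stronger_trans (stronger_trans r'r rq) qt].
Qed.

Lemma forces_mem_regular x y : regular (forces_mem x y).
Proof. by case: y => J g t; exact: dense_below_regular. Qed.

Lemma forces_regular a : regular (fun p => forces p a).
Proof.
elim: a => [|x y|x y|a [ma da] b [mb db]|a _ b _|a [ma _] b [mb db]|a IHa|a _] /=.
- by split=> // p /(_ p (stronger_refl p))[q []].
- exact: forces_mem_regular.
- exact: forces_eq_regular.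
- split=> [p q qp [pa pb]|p H]; first by split; [exact: ma pa|exact: mb pb].
  by split; [apply: da|apply: db]; apply: dense_below_sub H => q _ [].
- exact: dense_below_regular.
- split=> [p q qp H r rq|p H q qp qa]; first by apply: H; exact: stronger_trans qp.
  apply: db => r rq; have [t [tr H']] := H r (stronger_trans rq qp).
  exists t; split=> //; apply: H'; first exact: stronger_refl.
  by apply: ma qa; exact: stronger_trans rq.
- split=> [p q qp H x|p H x]; first exact: (IHa x).1 (H x).
  by apply: (IHa x).2; apply: dense_below_sub H.
- exact: dense_below_regular.
Qed.

Lemma forces_mono a p q : q <<= p -> forces p a -> forces q a.
Proof. exact: (forces_regular a).1. Qed.

Lemma forces_eq_mono x y p q : q <<= p -> forces_eq x y p -> forces_eq x y q.
Proof. exact: (forces_eq_regular x y).1. Qed.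

Lemma forces_mem_mono x y p q : q <<= p -> forces_mem x y p -> forces_mem x y q.
Proof. exact: (forces_mem_regular x y).1. Qed.

(* [forces] reduces eagerly to its fixpoint; these equivalences unfold one
   connective at a time. *)
Lemma forces_and p a b : forces p (fAnd a b) <-> forces p a /\ forces p b.
Proof. by []. Qed.

Lemma forces_all p (c : name P -> formula (name P)) :
  forces p (fAll c) <-> (forall x, forces p (c x)).
Proof. by []. Qed.

Lemma forces_imp p a b :
  forces p (fImp a b) <-> (forall q, q <<= p -> forces q a -> forces q b).
Proof. by []. Qed.

Lemma forces_iff p a b :
  forces p (fIff a b) <-> (forall q, q <<= p -> (forces q a <-> forces q b)).
Proof.
split=> [[ab ba] q qp|ab]; first by split; [exact: ab|exact: ba].
by split=> q qp; case: (ab q qp).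
Qed.

Lemma forces_ex_intro p (c : name P -> formula (name P)) x :
  forces p (c x) -> forces p (fEx c).
Proof. by move=> pc; apply: dense_below_of => q qp; exists x; exact: forces_mono pc. Qed.

Lemma forces_ex_elim p (c : name P -> formula (name P)) Q :
  forces p (fEx c) -> regular Q ->
  (forall x q, q <<= p -> forces q (c x) -> Q q) -> Q p.
Proof.
by move=> pc Qreg cQ; apply: dense_below_elim pc Qreg _ => q qp [x]; exact: cQ.
Qed.

Lemma forces_eq_refl x p : forces_eq x x p.
Proof.
elim: x p => I f IH s p.
by split=> i q qp qs; apply: dense_below_of => r rq; exists i; split=> //;
   exact: stronger_trans qs.
Qed.

Lemma forces_eq_sym x y p : forces_eq x y p -> forces_eq y x p.
Proof.
elim: x y p => I f IH s [J g t] p [xy yx].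
split=> [j q qp qt|i q qp qs].
- by apply: dense_below_sub (yx j q qp qt) => r _ [i [rs fg]]; exists i; split=> //; exact: IH.
- by apply: dense_below_sub (xy i q qp qs) => r _ [j [rt fg]]; exists j; split=> //; exact: IH.
Qed.

Lemma forces_eq_trans y x z p :
  forces_eq x y p -> forces_eq y z p -> forces_eq x z p.
Proof.
elim: x y z p => I f IH s [J g t] [K h u] p [xy yx] [yz zy].
split=> [i q qp qs|k q qp qu].
- apply: dense_below_elim (xy i q qp qs) (dense_below_regular _) _.
  move=> r rq [j [rt fg]].
  apply: dense_below_sub (yz j r (stronger_trans rq qp) rt) => r' r'r [k [r'u gh]].
  by exists k; split=> //; apply: IH gh; exact: forces_eq_mono fg.
- apply: dense_below_elim (zy k q qp qu) (dense_below_regular _) _.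
  move=> r rq [j [rt gh]].
  apply: dense_below_sub (yx j r (stronger_trans rq qp) rt) => r' r'r [i [r's fg]].
  by exists i; split=> //; apply: IH fg _; exact: forces_eq_mono gh.
Qed.

Lemma forces_mem_eql x x' y p :
  forces_eq x x' p -> forces_mem x y p -> forces_mem x' y p.
Proof.
case: y => J g t xx'; apply: dense_below_sub => q qp [j [qt xg]].
exists j; split=> //; apply: forces_eq_trans xg.
exact/forces_eq_sym/(forces_eq_mono qp).
Qed.

(** From right to left it is enough to test the members [f i] and [g j] of the two names at
    conditions below their labels. *)
Lemma forces_eq_ext x y p : forces_eq x y p <->
  (forall w q, q <<= p -> (forces_mem w x q <-> forces_mem w y q)).
Proof.
split=> [|xy].
  have sub x' y' w q : q <<= p -> forces_eq x' y' p ->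
      forces_mem w x' q -> forces_mem w y' q.
    case: x' y' => [I f s] [J g t] qp [xy _] wx.
    apply: dense_below_elim wx (dense_below_regular _) _ => r rq [i [rs wf]].
    apply: dense_below_sub (xy i r (stronger_trans rq qp) rs) => r' r'r [j [r't fg]].
    exists j; split=> //; apply: forces_eq_trans fg; exact: forces_eq_mono wf.
  by move=> xy w q qp; split; apply: sub => //; exact: forces_eq_sym.
case: x y xy => [I f s] [J g t] xy; split=> [i q qp qs|j q qp qt].
- have: forces_mem (f i) (nset f s) q.
    apply: dense_below_of => r rq; exists i; split; last exact: forces_eq_refl.
    exact: stronger_trans qs.
  by move=> /(xy _ q qp).
- have: forces_mem (g j) (nset g t) q.
    apply: dense_below_of => r rq; exists j; split; last exact: forces_eq_refl.
    exact: stronger_trans qt.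
  move=> /(xy _ q qp).2; apply: dense_below_sub => r rq [i [rs gf]].
  by exists i; split=> //; exact: forces_eq_sym.
Qed.

Lemma forces_mem_eqr x y y' p :
  forces_eq y y' p -> forces_mem x y p -> forces_mem x y' p.
Proof. by move=> /forces_eq_ext/(_ x p (stronger_refl p))[]. Qed.

(** * Names for ordered pairs and the formulas about them *)

Definition nupair x y : name P :=
  nset (fun b : bool => if b then x else y) (fun _ => weakest P).

Definition npair x y : name P := nupair (nupair x x) (nupair x y).

Lemma forces_mem_nupair w x y p : forces_mem w (nupair x y) p <->
  dense_below p (fun q => forces_eq w x q \/ forces_eq w y q).
Proof.
split; apply: dense_below_sub => q _.
- by move=> [[] [_ wb]]; [left|right].
- by move=> [wx|wy]; [exists true|exists false]; split=> //; exact: stronger_weakest.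
Qed.

Lemma forces_mem_nupair_l x y p : forces_mem x (nupair x y) p.
Proof. by apply/forces_mem_nupair/dense_below_of => q _; left; exact: forces_eq_refl. Qed.

Lemma forces_mem_nupair_r x y p : forces_mem y (nupair x y) p.
Proof. by apply/forces_mem_nupair/dense_below_of => q _; right; exact: forces_eq_refl. Qed.

Lemma nupair_congr x x' y y' p : forces_eq x x' p -> forces_eq y y' p ->
  forces_eq (nupair x y) (nupair x' y') p.
Proof.
have sub z z' w w' v q : forces_eq z z' q -> forces_eq w w' q ->
    forces_mem v (nupair z w) q -> forces_mem v (nupair z' w') q.
  move=> zz' ww' /forces_mem_nupair H; apply/forces_mem_nupair.
  apply: dense_below_sub H => r rq [vz|vw]; [left|right].
  - exact: forces_eq_trans vz (forces_eq_mono rq zz').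
  - exact: forces_eq_trans vw (forces_eq_mono rq ww').
move=> xx' yy'; apply/forces_eq_ext => v q qp.
have [qx qy] := (forces_eq_mono qp xx', forces_eq_mono qp yy').
by split; apply: sub => //; exact: forces_eq_sym.
Qed.

Lemma npair_congr x x' y y' p : forces_eq x x' p -> forces_eq y y' p ->
  forces_eq (npair x y) (npair x' y') p.
Proof. by move=> xx' yy'; do !apply: nupair_congr. Qed.

Lemma nupair_singleton_inj x y z p :
  forces_eq (nupair x x) (nupair y z) p -> forces_eq x y p.
Proof.
move=> /forces_eq_sym e; have := forces_mem_eqr e (@forces_mem_nupair_l y z p).
move=> /forces_mem_nupair H; apply: dense_below_elim H (forces_eq_regular _ _) _.
by move=> q _ [] /forces_eq_sym.
Qed.

Lemma nupair_cancel x y y' p :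
  forces_eq (nupair x y) (nupair x y') p -> forces_eq y y' p.
Proof.
move=> e; have := forces_mem_eqr e (@forces_mem_nupair_r x y p).
move=> /forces_mem_nupair H; apply: dense_below_elim H (forces_eq_regular _ _) _.
move=> q qp [yx|//].
have := forces_mem_eqr (forces_eq_sym e) (@forces_mem_nupair_r x y' p).
move=> /forces_mem_nupair/(dense_below_mono qp) H.
apply: dense_below_elim H (forces_eq_regular _ _) _ => r rq [y'x|]; last exact: forces_eq_sym.
exact: forces_eq_trans (forces_eq_mono rq yx) (forces_eq_sym y'x).
Qed.

(** Kuratowski's argument under forcing: the singleton member determines the first coordinate. Once
    [x'] is replaced by [x], two cancellations yield the second. *)
Lemma npair_inj x x' y y' p : forces_eq (npair x y) (npair x' y') p ->
  forces_eq x x' p /\ forces_eq y y' p.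
Proof.
move=> e; have xx' : forces_eq x x' p.
  have := forces_mem_eqr e (@forces_mem_nupair_l _ _ p).
  move=> /forces_mem_nupair H; apply: dense_below_elim H (forces_eq_regular _ _) _.
  by move=> q _ [] /nupair_singleton_inj.
split=> //; apply/(@nupair_cancel x)/(@nupair_cancel (nupair x x)).
apply: forces_eq_trans e _; have x'x := forces_eq_sym xx'.
by apply: npair_congr => //; exact: forces_eq_refl.
Qed.

Lemma forces_is_upair p z x y :
  forces p (is_upair z x y) <-> forces_eq z (nupair x y) p.
Proof.
split=> [/forces_all H|/forces_eq_ext H].
  apply/forces_eq_ext => w q qp.
  have zw : forces q (fMem w z) <-> forces q (fOr (fEq w x) (fEq w y)).
    by have /forces_iff := H w; exact.
  exact: (iff_trans zw (iff_sym (forces_mem_nupair w x y q))).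
apply/forces_all => w; apply/forces_iff => q qp.
exact: (iff_trans (H w q qp) (forces_mem_nupair w x y q)).
Qed.

Lemma forces_is_pair p z x y :
  forces p (is_pair z x y) <-> forces_eq z (npair x y) p.
Proof.
split=> [H|zxy].
  apply: forces_ex_elim H (forces_eq_regular _ _) _ => u q qp H.
  apply: forces_ex_elim H (forces_eq_regular _ _) _ => v r rq.
  move=> [/forces_is_upair ux [/forces_is_upair vxy /forces_is_upair zuv]].
  by apply: forces_eq_trans zuv _; exact: nupair_congr.
apply: (forces_ex_intro (x := nupair x x)); apply: (forces_ex_intro (x := nupair x y)).
by split; [|split]; apply/forces_is_upair => //; exact: forces_eq_refl.
Qed.

Lemma forces_related p f x y :
  forces p (related f x y) <-> forces_mem (npair x y) f p.
Proof.
split=> [H|fxy].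
  apply: forces_ex_elim H (forces_mem_regular _ _) _ => z q qp.
  by move=> [/forces_is_pair zxy zf]; exact: forces_mem_eql zxy zf.
apply: (forces_ex_intro (x := npair x y)); split=> //.
by apply/forces_is_pair; exact: forces_eq_refl.
Qed.

(** * Names of ground-model sets *)

Lemma check_vpair u v : check P (vpair u v) = npair (check P u) (check P v).
Proof.
have check_vupair u' v' : check P (vupair u' v') = nupair (check P u') (check P v').
  by rewrite /= /nupair; congr nset; apply: funext; case.
by rewrite /vpair /npair !check_vupair.
Qed.

(** Every label in a check name is the weakest condition, so the witnesses can be read off at any
    single condition and forced equality descends to the ground model. *)
Lemma check_inj u v p : forces_eq (check P u) (check P v) p -> Veq u v.
Proof.
elim: u v p => I f IH [J g] p [uv vu]; split=> [i|j].
- have [r [_ [j [_ fg]]]] :=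
    uv i p (stronger_refl p) (stronger_weakest p) p (stronger_refl p).
  by exists j; exact: IH fg.
- have [r [_ [i [_ fg]]]] :=
    vu j p (stronger_refl p) (stronger_weakest p) p (stronger_refl p).
  by exists i; exact: IH fg.
Qed.

Lemma forces_mem_check (I : Type) (f : I -> V) z p :
  forces_mem z (check P (vset f)) p <->
  dense_below p (fun q => exists i, forces_eq z (check P (f i)) q).
Proof.
split; apply: dense_below_sub => q _; first by move=> [i [_ zi]]; exists i.
by move=> [i zi]; exists i; split=> //; exact: stronger_weakest.
Qed.

Lemma forces_check_mem (I : Type) (f : I -> V) i p :
  forces_mem (check P (f i)) (check P (vset f)) p.
Proof. by apply/forces_mem_check/dense_below_of => q _; exists i; exact: forces_eq_refl. Qed.

End ForcingRelation.

(** * The generic order *)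

Section GenericOrder.
Variables (S : Type) (elt : S -> V).
Hypothesis elt_inj : forall s t : S, Veq (elt s) (elt t) -> s = t.

Local Notation P := (Fn S).
Implicit Types (p q r : P) (x y z f : name P) (s t : S) (A : finite_order S).

Local Notation "s ^v" := (check P (elt s)) (at level 2, format "s ^v").
Local Notation G := (@generic_filter P (@Fn_code S elt)).
Local Notation U := (check P (vset elt)).

(** A name for the order relation of the union of the generic filter. *)
Definition generic_order : name P :=
  nset (fun a : {a : P * (S * S) | order_rel a.1 a.2.1 a.2.2} =>
          npair (sval a).2.1^v (sval a).2.2^v)
       (fun a => (sval a).1).

Local Notation R := generic_order.

Lemma order_rel_extends q r s t :
  r <<= q -> order_rel q s t -> order_rel r s t.
Proof.
by move=> rq st; have [qs qt] := order_rel_carrier st; rewrite -(rq.2 _ _ qs qt).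
Qed.

Lemma dense_carrier p s : dense_below p (fun q => carrier q s).
Proof. by move=> q _; exact: extends_with_point. Qed.

Lemma check_elt_inj s t p : forces_eq s^v t^v p -> s = t.
Proof. by move=> /check_inj/elt_inj. Qed.

Lemma forces_mem_order z p : forces_mem z R p <->
  dense_below p (fun q => exists s t, order_rel q s t /\ forces_eq z (npair s^v t^v) q).
Proof.
split; apply: dense_below_sub => q _.
  move=> [[[A [s t]] /= Ast] [qA zst]]; exists s, t; split=> //.
  exact: order_rel_extends qA Ast.
move=> [s [t [qst zst]]].
by exists (exist _ (q, (s, t)) qst); split=> //; exact: stronger_refl.
Qed.

Lemma forces_related_order p x y : forces p (related R x y) <->
  dense_below p (fun q => exists s t,
    [/\ forces_eq x s^v q, forces_eq y t^v q & order_rel q s t]).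
Proof.
apply: (iff_trans (forces_related _ _ _ _)).
apply: (iff_trans (forces_mem_order _ _)); split; apply: dense_below_sub => q _.
  by move=> [s [t [st /npair_inj[xs yt]]]]; exists s, t.
by move=> [s [t [xs yt st]]]; exists s, t; split=> //; exact: npair_congr.
Qed.

(** A condition decides the order on its own carrier, because a stronger condition contains it as a
    suborder and adds no relation between its points. *)
Lemma forces_related_order_check q s t : carrier q s -> carrier q t ->
  (forces q (related R s^v t^v) <-> order_rel q s t).
Proof.
move=> qs qt; split=> [/forces_related_order H|st].
  have [r [rq [s' [t' [/check_elt_inj<- /check_elt_inj<- st]]]]] :=
    H q (stronger_refl q).
  by rewrite (rq.2 _ _ qs qt).
apply/forces_related_order/dense_below_of => r rq; exists s, t.
split; [exact: forces_eq_refl..|exact: order_rel_extends st].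
Qed.

(** Together with [order_code] this names the two components of [Fn_code elt A]. *)
Definition carrier_code A : V := vset (fun s : {s | carrier A s} => elt (sval s)).

Definition order_code A : V :=
  vset (fun st : {st : S * S | order_rel A st.1 st.2} =>
          vpair (elt (sval st).1) (elt (sval st).2)).

Lemma forces_mem_carrier_code A z p :
  forces_mem z (check P (carrier_code A)) p <->
  dense_below p (fun q => exists s, carrier A s /\ forces_eq z s^v q).
Proof.
apply: (iff_trans (forces_mem_check _ _ _)); split; apply: dense_below_sub => q _.
  by move=> [[s As] zs]; exists s.
by move=> [s [As zs]]; exists (exist _ s As).
Qed.

Lemma forces_mem_order_code A z p :
  forces_mem z (check P (order_code A)) p <->
  dense_below p (fun q => exists s t,
    order_rel A s t /\ forces_eq z (npair s^v t^v) q).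
Proof.
apply: (iff_trans (forces_mem_check _ _ _)); split; apply: dense_below_sub => q _.
  by move=> [[[s t] st] zst]; exists s, t; rewrite -check_vpair.
move=> [s [t [st]]]; rewrite -check_vpair => zst.
by exists (exist _ (s, t) st).
Qed.

(** Densely, a member of [G] equals the coded pair of a condition weaker than the current one;
    [c_congr] then exchanges its components for the two codes. *)
Lemma forces_ex_structure p (c : name P -> name P -> formula (name P)) :
  (forall q x x' y y', forces_eq x x' q -> forces_eq y y' q ->
     forces q (c x y) -> forces q (c x' y')) ->
  (forces p (fEx (fun g => fEx (fun x => fEx (fun y =>
     fAnd (fMem g G) (fAnd (is_pair g x y) (c x y)))))) <->
   dense_below p (fun q => exists A, q <<= A /\
     forces q (c (check P (carrier_code A)) (check P (order_code A))))).
Proof.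
move=> c_congr; split=> H.
  apply: forces_ex_elim H (dense_below_regular _) _ => g q qp H.
  apply: forces_ex_elim H (dense_below_regular _) _ => x {}q1 q1q H.
  apply: forces_ex_elim H (dense_below_regular _) _ => y q2 q21.
  move=> [gG [/forces_is_pair gxy cxy]].
  apply: dense_below_sub gG => r rq [A [rA gA]]; exists A; split=> //.
  have e : forces_eq (npair x y) (check P (Fn_code elt A)) r.
    apply: forces_eq_trans gA; apply: forces_eq_sym; exact: forces_eq_mono gxy.
  move: e; rewrite check_vpair => /npair_inj[ex ey].
  by apply: c_congr ex ey _; exact: forces_mono cxy.
apply: dense_below_elim H (forces_regular _) _ => q qp [A [qA cA]].
apply: (forces_ex_intro (x := check P (Fn_code elt A))).
apply: (forces_ex_intro (x := check P (carrier_code A))).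
apply: (forces_ex_intro (x := check P (order_code A))).
split; last split=> //.
  apply: dense_below_of => r rq; exists A; split; last exact: forces_eq_refl.
  exact: stronger_trans qA.
by apply/forces_is_pair; rewrite -check_vpair; exact: forces_eq_refl.
Qed.

Lemma forces_union_of_structures p : forces p (is_union_of_structures G U R).
Proof.
split; apply/forces_all => z; apply/forces_iff => q qp.
  apply: iff_trans (iff_sym (@forces_ex_structure q (fun x _ => fMem z x) _)); last first.
    by move=> r x x' y y' xx' _; exact: forces_mem_eqr.
  apply: (iff_trans (forces_mem_check _ _ _)); split=> H.
    (* Density of the conditions containing [s] is what makes the underlying set of the union all of
       [S]. *)
    apply: dense_below_elim H (dense_below_regular _) _ => r rq [s zs].
    apply: dense_below_sub (@dense_carrier r s) => r' r'r r's.
    exists r'; split; first exact: stronger_refl.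
    apply/forces_mem_carrier_code/dense_below_of => q1 q1r'; exists s; split=> //.
    exact: forces_eq_mono (stronger_trans q1r' r'r) zs.
  apply: dense_below_elim H (dense_below_regular _) _ => r rq.
  move=> [A [_ /forces_mem_carrier_code]].
  by apply: dense_below_sub => r' _ [s [_ zs]]; exists s.
apply: iff_trans (iff_sym (@forces_ex_structure q (fun _ x => fMem z x) _)); last first.
  by move=> r x x' y y' _ yy'; exact: forces_mem_eqr.
apply: (iff_trans (forces_mem_order _ _)); split=> H.
  apply: dense_below_sub H => r rq [s [t [st zst]]].
  exists r; split; first exact: stronger_refl.
  apply/forces_mem_order_code/dense_below_of => q1 q1r; exists s, t; split=> //.
  exact: forces_eq_mono zst.
apply: dense_below_elim H (dense_below_regular _) _ => r rq.
move=> [A [rA /forces_mem_order_code]].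
apply: dense_below_sub => r' r'r [s [t [Ast zst]]]; exists s, t; split=> //.
by apply: order_rel_extends Ast; exact: stronger_trans rA.
Qed.

(** Each order axiom reduces to the same axiom for one finite order: a strong enough condition
    identifies the elements involved with points of [S] and contains the relations between them. *)
Lemma forces_partial_order p : forces p (is_partial_order U R).
Proof.
split; [|split; [|split]].
- apply/forces_all => z; apply/forces_imp => q qp /forces_mem_order H.
  apply: dense_below_elim H (forces_regular _) _ => r rq [s [t [_ zst]]].
  apply: (forces_ex_intro (x := s^v)); apply: (forces_ex_intro (x := t^v)).
  by split; [|split; [|exact/forces_is_pair]]; exact: forces_check_mem.
- apply/forces_all => x; apply/forces_imp => q qp /forces_mem_check H.
  apply: dense_below_elim H (forces_regular _) _ => r rq [s xs].
  apply/forces_related_order; apply: dense_below_sub (@dense_carrier r s).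
  move=> r' r'r r's; have xs' := forces_eq_mono r'r xs.
  by exists s, s; split=> //; exact: order_rel_refl.
- apply/forces_all => x; apply/forces_all => y; apply/forces_imp => q qp.
  move=> /forces_related_order xy; apply/forces_imp => r rq /forces_related_order yx.
  apply: dense_below_elim (dense_below_mono rq xy) (forces_regular _) _.
  move=> r1 r1r [s [t [xs yt st]]].
  apply: dense_below_elim (dense_below_mono r1r yx) (forces_regular _) _.
  move=> r2 r2r1 [t' [s' [yt' xs' ts]]].
  have [{}xs {}yt] := (forces_eq_mono r2r1 xs, forces_eq_mono r2r1 yt).
  have e : s = s' by apply: check_elt_inj (forces_eq_trans (forces_eq_sym xs) xs').
  have e' : t = t' by apply: check_elt_inj (forces_eq_trans (forces_eq_sym yt) yt').
  subst s' t'; have e := order_rel_anti (order_rel_extends r2r1 st) ts.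
  by subst t; exact: forces_eq_trans xs (forces_eq_sym yt).
- apply/forces_all => x; apply/forces_all => y; apply/forces_all => z.
  apply/forces_imp => q qp /forces_related_order xy.
  apply/forces_imp => r rq /forces_related_order yz; apply/forces_related_order.
  apply: dense_below_elim (dense_below_mono rq xy) (dense_below_regular _) _.
  move=> r1 r1r [s [t [xs yt st]]].
  apply: dense_below_sub (dense_below_mono r1r yz).
  move=> r2 r2r1 [t' [u [yt' zu tu]]].
  have [{}xs {}yt] := (forces_eq_mono r2r1 xs, forces_eq_mono r2r1 yt).
  have e : t = t' by apply: check_elt_inj (forces_eq_trans (forces_eq_sym yt) yt').
  subst t'; exists s, u; split=> //.
  exact: order_rel_trans (order_rel_extends r2r1 st) tu.
Qed.

(** * Rigidity of the generic order *)

Lemma forces_mem_relation p X f z : forces p (is_relation_on X f) ->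
  forces_mem z f p ->
  dense_below p (fun q => exists x y,
    [/\ forces_mem x X q, forces_mem y X q & forces_eq z (npair x y) q]).
Proof.
move=> /forces_all/(_ z)/forces_imp/(_ p (stronger_refl p)) H /H {}H.
apply: forces_ex_elim H (dense_below_regular _) _ => x q qp H.
apply: dense_below_sub H => r rq [y [xX [yX /forces_is_pair zxy]]].
by exists x, y.
Qed.

Lemma forces_rigid p : ~ countable [set: S] -> forces p (is_rigid U R).
Proof.
move=> S_unc; apply/forces_all => f; apply/forces_imp => {}p _.
move=> /forces_and[/forces_and[f_rel /forces_and[f_tot]]].
move=> /forces_and[_ /forces_and[f_inj _]] f_order.
pose F s t q := forces q (related f s^v t^v).
have F_mono s t q r : F s t q -> r <<= q -> F s t r.
  by move=> Fst rq; exact: forces_mono Fst.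
have F_total s q : q <<= p -> exists r t, r <<= q /\ F s t r.
  move=> qp.
  have Us : forces q (fMem s^v U) by exact: forces_check_mem.
  have := f_tot s^v q qp Us.
  move=> /(_ q (stronger_refl q))[q1 [q1q [y fsy]]].
  have /forces_related fsy' := fsy.
  have q1p := stronger_trans q1q qp.
  (* The value [y] is only a name. Since the relation lives on [U], a further extension decides
     which point [t] of [S] it is. *)
  have [q2 [q21 [x' [y' [_ /forces_mem_check Uy' /npair_inj[_ yy']]]]]] :=
    forces_mem_relation (forces_mono q1p f_rel) fsy' (stronger_refl q1).
  have [r [r2 [t y't]]] := Uy' q2 (stronger_refl q2).
  exists r, t; split; first exact: stronger_trans r2 (stronger_trans q21 q1q).
  apply/forces_related; apply: forces_mem_eql; last first.
    exact: forces_mem_mono (stronger_trans r2 q21) fsy'.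
  apply: npair_congr; first exact: forces_eq_refl.
  exact: forces_eq_trans (forces_eq_mono r2 yy') y't.
have F_diag s t q : q <<= p -> F s t q -> s = t.
  apply: invariant_assignment_trivial => //.
  - move=> s1 s2 t1 q1 q1p H1 H2; apply: (@check_elt_inj _ _ q1).
    exact: (f_inj s1^v s2^v t1^v q1 q1p H1 q1 (@stronger_refl P q1) H2).
  - move=> s1 s2 t1 t2 q1 q1p H1 H2 cs1 cs2 ct1 ct2.
    have H : forces (P := P) q1 (fIff (related R s1^v s2^v) (related R t1^v t2^v)).
      exact: (f_order _ _ _ _ q1 q1p H1 q1 (@stronger_refl P q1) H2).
    have := (forces_iff _ _ _).1 H q1 (@stronger_refl P q1).
    by rewrite !forces_related_order_check.
(* [F_diag] speaks of points of [S] only, so in both inclusions the coordinates of [z] are first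
   identified with check names. *)
apply/forces_all => z; apply/forces_iff => q qp; split=> [zf|H].
  have := forces_mem_relation (forces_mono qp f_rel) zf.
  move=> H; apply: dense_below_elim H (forces_regular _) _ => q1 q1q.
  move=> [x [y [/forces_mem_check Ux /forces_mem_check Uy zxy]]].
  apply: dense_below_elim Ux (forces_regular _) _ => q2 q21 [s xs].
  apply: dense_below_elim (dense_below_mono q21 Uy) (forces_regular _) _ => r r2 [t yt].
  have zst : forces_eq z (npair s^v t^v) r.
    apply: forces_eq_trans (forces_eq_mono (stronger_trans r2 q21) zxy) _.
    exact: npair_congr (forces_eq_mono r2 xs) yt.
  have rq := stronger_trans r2 (stronger_trans q21 q1q).
  have e : s = t.
    apply: (F_diag s t r); first exact: stronger_trans rq qp.
    by apply/forces_related; exact: forces_mem_eql zst (forces_mono rq zf).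
  subst t; apply: (forces_ex_intro (x := s^v)).
  by split; [exact: forces_check_mem|exact/forces_is_pair].
apply: forces_ex_elim H (forces_regular _) _ => x q1 q1q [/forces_mem_check Ux].
move=> /forces_is_pair zxx.
apply: dense_below_elim Ux (forces_regular _) _ => q2 q21 [s xs].
(* For the pair of [s] with itself to lie in [f], totality supplies densely some image [t] of [s],
   and [F_diag] makes it [s]. *)
apply: (forces_regular (fMem z f)).2 => q3 q32.
have q3p := stronger_trans q32 (stronger_trans q21 (stronger_trans q1q qp)).
have [r [t [r3 Fst]]] := F_total s q3 q3p.
exists r; split=> //; have e := F_diag s t r (stronger_trans r3 q3p) Fst; subst t.
have /forces_related := Fst; apply: forces_mem_eql; apply: forces_eq_sym.
have r2 := stronger_trans r3 q32; have xs' := forces_eq_mono r2 xs.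
apply: forces_eq_trans (forces_eq_mono (stronger_trans r2 q21) zxx) _.
exact: npair_congr.
Qed.

End GenericOrder.

(* The ground-model set S is given by an injective enumeration elt of its
   elements. *)
Theorem theorem3 (S : Type) (elt : S -> V)
    (elt_inj : forall s t : S, Veq (elt s) (elt t) -> s = t)
    (S_uncountable : ~ countable (@setT S)) :
  generic_extension_satisfies
    (union_is_rigid_order_on
       (@generic_filter (Fn S) (@Fn_code S elt))
       (check (Fn S) (vset elt))).
Proof.
apply: (forces_ex_intro (x := check (Fn S) (vset elt))).
apply: (forces_ex_intro (x := generic_order elt)).
split; first exact: forces_union_of_structures.
split; first exact: forces_eq_refl.
by split; [exact: forces_partial_order|exact: forces_rigid].
Qed.
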